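(* Let $n\ge 1$ and let $L \in \mathcal{L}_n$. Then the number of $P_1$-matches in $L$, where $P_1=EENN$, is the number of east steps of $L$ below the subdiagonal $y=x-1$. Hence, by symmetry, the number of $P_6$-matches in $L$, where $P_6=NNEE$, is the number of north steps of $L$ above the superdiagonal $y=x+1$.
   Context: $\mathcal{L}_n$ is the set of lattice paths from $(0,0)$ to $(n,n)$ consisting of unit north steps $N=(0,1)$ and unit east steps $E=(1,0)$, equivalently words with $n$ letters $E$ and $n$ letters $N$. For $L\in\mathcal{L}_n$ and $A\subseteq\{1,\dots,n\}$, $ps_L(A)$ is the word obtained from $L$ by deleting, for every $i\in\{1,\dots,n\}\setminus A$, the $i$-th occurrence of $E$ and the $i$-th occurrence of $N$ (reading from left to right). For $P\in\mathcal{L}_2$, the number of $P$-matches in $L$ is the number of $j\in\{1,\dots,n-1\}$ with $ps_L(\{j,j+1\})=P$. An east step from $(a,b)$ to $(a+1,b)$ is below the subdiagonal $y=x-1$ if $b\le a-1$ (i.e. its endpoint lies strictly below the line $y=x-1$); a north step from $(a,b)$ to $(a,b+1)$ is above the superdiagonal $y=x+1$ if $b\ge a+1$ (i.e. its endpoint lies strictly above the line $y=x+1$). *)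

(* Defs.v *)
From HB Require Import structures.
From mathcomp Require Import all_boot.

Set Implicit Arguments.
Unset Strict Implicit.
Unset Printing Implicit Defensive.

Variant step : Type := E | N.

Definition is_east (s : step) : bool := if s is E then true else false.
Definition step_of_bool (b : bool) : step := if b then E else N.
Lemma is_eastK : cancel is_east step_of_bool. Proof. by case. Qed.
HB.instance Definition _ := Equality.copy step (can_type is_eastK).

Definition word := seq step.

Definition lattice_path (n : nat) : {pred word} :=
  [pred L | (count_mem E L == n) && (count_mem N L == n)].

(* Positions i in a word are 0-based, occurrences of a letter are 1-based:
   the letter at position i < size L is the (occurrence L i)-th of its kind. *)
Definition occurrence (L : word) (i : nat) : nat :=
  count_mem (nth E L i) (take i.+1 L).

(* When L is in lattice_path n, all occurrence numbers lie in {1, ..., n}, so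
   deleting those in {1, ..., n} \ A amounts to keeping those in A. *)
Definition ps (L : word) (A : {pred nat}) : word :=
  [seq nth E L i | i <- iota 0 (size L) & occurrence L i \in A].

Definition matches (n : nat) (P L : word) : nat :=
  count (fun j => ps L (pred2 j j.+1) == P) (index_iota 1 n).

Definition P1 : word := [:: E; E; N; N].
Definition P6 : word := [:: N; N; E; E].

(* The step at position i starts at the lattice point (xstart L i, ystart L i). *)
Definition xstart (L : word) (i : nat) : nat := count_mem E (take i L).
Definition ystart (L : word) (i : nat) : nat := count_mem N (take i L).

(* b <= a - 1 over the integers is b + 1 <= a; subtraction on nat would
   wrongly accept a = b = 0. *)
Definition east_below_subdiag (L : word) (i : nat) : bool :=
  (nth E L i == E) && (ystart L i + 1 <= xstart L i).

Definition north_above_superdiag (L : word) (i : nat) : bool :=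
  (nth E L i == N) && (xstart L i + 1 <= ystart L i).

Definition num_east_below_subdiag (L : word) : nat :=
  count (east_below_subdiag L) (iota 0 (size L)).

Definition num_north_above_superdiag (L : word) : nat :=
  count (north_above_superdiag L) (iota 0 (size L)).

(* Main.v *)
(** Let j = a be the number of east steps before a given east step, so that the
    step is the (j+1)-th E.  It lies below the subdiagonal iff fewer than j
    letters N precede it, i.e. iff the (j+1)-th E precedes the j-th N; this is
    exactly the condition for [ps L {j, j+1}] to be EENN.  The east steps of L
    are in bijection with the values 0, ..., n-1 of j, and j = 0 never
    contributes.  The argument is the same with the letters exchanged. *)
Require Import Defs.
From mathcomp Require Import all_boot.
From mathcomp Require Import zify.

(** Working with a letter [s] and its opposite treats both claims at once. *)
Definition flip (s : step) : step := if s is E then N else E.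

Lemma count_step (s : step) (w : word) :
  count_mem s w + count_mem (flip s) w = size w.
Proof. by elim: w => //= x w <-; case: s x => [] []; rewrite /=; lia. Qed.

Lemma word_nseq (s : step) (w : word) :
  count_mem (flip s) w = 0 -> w = nseq (count_mem s w) s.
Proof.
move=> h; have /all_pred1P -> : all (pred1 s) w.
  by rewrite all_count -(count_step s w) h addn0.
by rewrite count_nseq /= eqxx mul1n.
Qed.

Lemma iota_rcons (m n : nat) : iota m n.+1 = rcons (iota m n) (m + n).
Proof. by rewrite -addn1 iotaD cats1. Qed.

Lemma occurrence_cat (u v : word) (i : nat) :
  i < size u -> occurrence (u ++ v) i = occurrence u i.
Proof. by move=> lt_iu; rewrite /occurrence nth_cat lt_iu takel_cat. Qed.

(** An occurrence number depends only on the prefix ending at its position, so appending a letter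
    leaves the earlier choices unchanged. This permits induction from the right. *)
Lemma ps_rcons (w : word) (x : step) (A : {pred nat}) :
  ps (rcons w x) A =
  ps w A ++ (if (count_mem x w).+1 \in A then [:: x] else [::]).
Proof.
rewrite /ps size_rcons iota_rcons filter_rcons add0n.
have -> : occurrence (rcons w x) (size w) = (count_mem x w).+1.
  rewrite /occurrence nth_rcons ltnn eqxx -(size_rcons w x) take_size.
  by rewrite -cats1 count_cat /= eqxx addn1.
have -> : [seq nth E w i | i <- iota 0 (size w) & occurrence w i \in A] =
          [seq nth E (rcons w x) i
             | i <- iota 0 (size w) & occurrence (rcons w x) i \in A].
  rewrite -[in RHS](@eq_in_filter _ (fun i => occurrence w i \in A)) => [|i].
    apply/eq_in_map => i; rewrite mem_filter mem_iota nth_rcons.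
    by move=> /and3P[_ _ ->].
  by rewrite mem_iota => /andP[_ lt_iw]; rewrite -cats1 occurrence_cat.
by case: ifP; rewrite ?cats0 // map_rcons nth_rcons ltnn eqxx cats1.
Qed.

Lemma ps_cat (u v : word) (A : {pred nat}) :
  exists r, ps (u ++ v) A = ps u A ++ r.
Proof.
elim/last_ind: v => [|v x [r IH]]; first by exists [::]; rewrite !cats0.
by rewrite -rcons_cat ps_rcons IH -catA; eexists.
Qed.

(** The copies of [s] in [w] carry the numbers 1, 2, ..., [count_mem s w], each exactly once. *)
Lemma count_ps (s : step) (w : word) (A : {pred nat}) :
  count_mem s (ps w A) = count (mem A) (iota 1 (count_mem s w)).
Proof.
elim/last_ind: w => // w x IH; rewrite ps_rcons count_cat IH.
rewrite -cats1 count_cat /= addn0; case: (eqVneq x s) => [->|/negPf ne_xs].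
  by rewrite iotaD count_cat /= add1n; case: ifP; rewrite /= ?eqxx.
by rewrite [count_mem s w + _]addn0; case: ifP; rewrite /= ?ne_xs; lia.
Qed.

Lemma count_pred2_iota (j c : nat) :
  0 < j -> count (mem (pred2 j j.+1)) (iota 1 c) = (j <= c) + (j < c).
Proof.
move=> j_gt0; elim: c => [|c IH]; first by case: j j_gt0.
by rewrite iota_rcons -cats1 count_cat IH /= inE; lia.
Qed.

(** The displayed [s] is number [j.+1], hence kept. Since [ps L A] has two letters of each kind,
    only the place of the opposite letters relative to this [s] is in doubt, and one precedes it iff
    the [j]-th of them lies in [u]. *)
Lemma ps_ssoo (s : step) (u v : word) (L := u ++ s :: v) (j := count_mem s u) :
    0 < j -> j < count_mem (flip s) L ->
  (ps L (pred2 j j.+1) == [:: s; s; flip s; flip s]) =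
  (count_mem (flip s) u < j).
Proof.
move=> j_gt0 lt_jL; set o := flip s; set A := pred2 j j.+1.
have ne_so : (s == o) = false by rewrite /o; case: (s).
have [r psL] : exists r, ps L A = ps u A ++ s :: r.
  have [r] := ps_cat (rcons u s) v A.
  by rewrite cat_rcons ps_rcons !inE eqxx orbT -catA; exists r.
have us : count_mem s (ps u A) = 1.
  by rewrite count_ps count_pred2_iota // leqnn ltnn.
have uo : count_mem o (ps u A) = (j <= count_mem o u) + (j < count_mem o u).
  by rewrite count_ps count_pred2_iota.
have Ls : count_mem s (ps L A) = 2.
  by rewrite count_ps count_pred2_iota // count_cat /= eqxx -/j; lia.
have Lo : count_mem o (ps L A) = 2.
  by rewrite count_ps count_pred2_iota // lt_jL ltnW.
move: Ls Lo; rewrite psL !count_cat /= eqxx ne_so us => rs ro.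
(* Both kept copies of [s] are already located, one in [ps u A] and the displayed one, so [r] has
   none. *)
have rE : r = nseq (count_mem o r) o.
  by apply: word_nseq; rewrite /o; case: (s) rs => /=; lia.
apply/eqP/idP => [psE | lt_uj].
  (* With exactly one [s] in it, [ps u A] can start the pattern only as [[:: s]]. *)
  case: (ps u A) psE us uo => [|x [|y w]] //=; last first.
    by case=> -> -> _; rewrite eqxx.
  by case=> -> _ _; rewrite ne_so; lia.
have uo0 : count_mem o (ps u A) = 0.
  by rewrite uo leqNgt lt_uj ltnNge (ltnW lt_uj).
rewrite (word_nseq s _ uo0) us rE; suff -> : count_mem o r = 2 by [].
by rewrite uo0 in ro.
Qed.

(** The k-th [s] has k - 1 copies of [s] before it; this reindexes positions of [s] by the values of
    [j]. *)
Lemma map_count_take (s : step) (w : word) :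
  [seq count_mem s (take i w) | i <- iota 0 (size w) & nth E w i == s] =
  iota 0 (count_mem s w).
Proof.
elim/last_ind: w => // w x IH.
rewrite size_rcons iota_rcons filter_rcons add0n nth_rcons ltnn eqxx.
rewrite -[in RHS]cats1 count_cat /= addn0 iotaD -IH.
have -> : [seq i <- iota 0 (size w) | nth E (rcons w x) i == s] =
          [seq i <- iota 0 (size w) | nth E w i == s].
  by apply: eq_in_filter => i; rewrite mem_iota nth_rcons => /andP[_ ->].
have eq_map : [seq count_mem s (take i (rcons w x))
                | i <- iota 0 (size w) & nth E w i == s] =
          [seq count_mem s (take i w) | i <- iota 0 (size w) & nth E w i == s].
  apply/eq_in_map => i; rewrite mem_filter mem_iota => /and3P[_ _ lt_iw].
  by rewrite -cats1 takel_cat // ltnW.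
case: eqP => _; last by rewrite eq_map cats0.
by rewrite map_rcons eq_map -cats1 -cats1 take_size_cat.
Qed.

Lemma matches_ssoo (n : nat) (s : step) (L : word) :
    0 < n -> count_mem s L = n -> count_mem (flip s) L = n ->
  matches n [:: s; s; flip s; flip s] L =
  count (fun i => (nth E L i == s) &&
           (count_mem (flip s) (take i L) + 1 <= count_mem s (take i L)))
        (iota 0 (size L)).
Proof.
move=> n_gt0 Ls Lo; set P := [:: s; s; _; _].
(* The guard makes [j = 0] contribute nothing, so the range can start at 0 as in
   [map_count_take]. *)
pose f j := (0 < j) && (ps L (pred2 j j.+1) == P).
have -> : matches n P L = count f (iota 0 n).
  rewrite /matches /index_iota -{2}(subnKC n_gt0) iotaD count_cat /= !add0n.
  by apply: eq_in_count => j; rewrite mem_iota /f => /andP[->].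
rewrite -Ls -map_count_take count_map count_filter.
apply: eq_in_count => i; rewrite mem_iota => /andP[_ lt_iL] /=.
rewrite andbC; case: eqP => //= Li.
have LE : L = take i L ++ s :: drop i.+1 L.
  by rewrite -{1}(cat_take_drop i L) (drop_nth E) // Li.
rewrite /f; case: posnP => [->|j_gt0] /=; first by rewrite addn1.
(* What remains is the bound [j < n]: the [s] at position [i] is itself not counted in [j]. *)
rewrite {1}LE ps_ssoo ?addn1 // -LE Lo -Ls [in ltnRHS]LE count_cat /= eqxx.
by lia.
Qed.

Theorem theorem3 (n : nat) (hn : 1 <= n) (L : word) (hL : L \in lattice_path n) :
  matches n P1 L = num_east_below_subdiag L /\
  matches n P6 L = num_north_above_superdiag L.
Proof.
move: hL => /andP[/eqP LE /eqP LN].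
by split; [apply: (@matches_ssoo n E) | apply: (@matches_ssoo n N)].
Qed.
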